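(* Let the distribution $\mu_\beta$ satisfy (G1) and (G2). Then its (incomplete) moment matrix $M$ satisfies $\mathrm{rank}(M)\le K$.
   Context: Setting: $J\ge1$ and $L=(L_1,\dots,L_J)$ are positive integers, $|L|=\sum_jL_j$; coordinates of $\mathbb{R}^{|L|}$ are indexed by pairs $(j,l)$, $1\le j\le J$, $1\le l\le L_j$. $\mathbb{S}^L=\{\beta\in\mathbb{R}^{|L|}:\beta_{jl}\ge0,\ \sum_l\beta_{jl}=1\text{ for all }j\}$. $\mu_\beta$ is a Borel probability measure on $\mathbb{R}^{|L|}$ with $\mu_\beta(\mathbb{S}^L)=1$. $\beta$ is a random vector with law $\mu_\beta$, and $X=(X_1,\dots,X_J)$ is a random vector, $X_j\in\{1,\dots,L_j\}$, with $\Pr(X_j=l\mid\beta)=\beta_{jl}$. (G1): conditionally on $\beta$, $X_1,\dots,X_J$ are mutually independent. (G2): there is a $K$-dimensional linear subspace $Q\subseteq\mathbb{R}^{|L|}$ with $\mu_\beta(Q)=1$ such that no proper linear subspace of $Q$ has $\mu_\beta$-measure $1$. Indices: $\mathcal{L}^0=\{\ell\in\mathbb{Z}^J:0\le\ell_j\le L_j\}$, $\mathcal{L}=\{\ell\in\mathcal{L}^0:\ell_j\ge1\text{ for all }j\}$. The vector $\boldsymbol{l}_j\in\mathbb{Z}^J$ has $j$-th component $l$ and other components $0$. For $\ell\in\mathcal{L}^0$, $M_\ell=\int\prod_{j:\ell_j\ne0}\beta_{j\ell_j}\,\mu_\beta(d\beta)$. Moment matrix $M$: an incomplete matrix with rows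 indexed by pairs $(j,l)$ and columns indexed by $\ell\in\mathcal{L}^0\setminus\mathcal{L}$; the entry in row $(j,l)$, column $\ell$ is $M_{\ell+\boldsymbol{l}_j}$ if $\ell_j=0$ (a known entry), and is unspecified if $\ell_j\ne0$. The rank of an incomplete matrix is the maximal size of a nonzero minor containing only known entries. *)

(* Defs.v *)
From HB Require Import structures.
From mathcomp Require Import all_boot all_order all_algebra.
From mathcomp Require Import all_classical all_reals all_analysis.
Set Implicit Arguments.
Unset Strict Implicit.
Unset Printing Implicit Defensive.
Import Order.TTheory GRing.Theory Num.Theory.
Import numFieldNormedType.Exports.
Local Open Scope classical_set_scope.
Local Open Scope ring_scope.

(* All the 1-based indices l = 1, ..., L_j are encoded as elements of 'I_(L j),
   that is, l is represented by l - 1. *)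

(* R^|L| with its Borel sigma-algebra. *)
Definition coefSpace (R : realType) (J : nat) (L : 'I_J -> nat) :=
  g_sigma_algebraType (open : set (set 'rV[R]_(\sum_(j < J) L j))).

Definition coef (R : realType) (J : nat) (L : 'I_J -> nat)
    (b : coefSpace R L) (j : 'I_J) (l : 'I_(L j)) : R :=
  (b : 'rV[R]_(\sum_(j < J) L j)) ord0 (tagnat.Rank j l).

(* The product of simplices S^L. *)
Definition simplices (R : realType) (J : nat) (L : 'I_J -> nat) :
    set (coefSpace R L) :=
  [set b | (forall j (l : 'I_(L j)), 0 <= coef b l) /\
           (forall j, \sum_(l < L j) coef b l = 1)].

(* g is a version of the conditional probability Pr(A | beta), seen as a
   function of the value of beta. *)
Definition is_cond_prob d d' (Omega : measurableType d) (T : measurableType d')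
    (R : realType) (P : probability Omega R) (beta : {RV P >-> T})
    (A : set Omega) (g : T -> R) : Prop :=
  (distribution P beta).-integrable [set: T] (EFin \o g) /\
  forall B : set T, measurable B ->
    P (A `&` beta @^-1` B) = (\int[distribution P beta]_(b in B) (g b)%:E)%E.

(* Mutual independence of X_1, ..., X_J conditionally on beta. Since the A j
   may be the full set, the product rule for subfamilies is included. *)
Definition G1 d d' (Omega : measurableType d) (T : measurableType d')
    (R : realType) (P : probability Omega R) (beta : {RV P >-> T})
    (J : nat) (L : 'I_J -> nat) (X : forall j : 'I_J, Omega -> 'I_(L j)) :
    Prop :=
  forall (A : forall j : 'I_J, set 'I_(L j)) (g : 'I_J -> T -> R),
    (forall j, is_cond_prob beta (X j @^-1` A j) (g j)) ->
    is_cond_prob beta [set w | forall j, A j (X j w)]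
      (fun b => \prod_(j < J) g j b).

Definition G2 (R : realType) (J : nat) (L : 'I_J -> nat)
    (mu : probability (coefSpace R L) R) (K : nat) : Prop :=
  exists Q : {vspace 'rV[R]_(\sum_(j < J) L j)},
    [/\ \dim Q = K,
        mu [set b | b \in Q] = 1%E &
        forall Q' : {vspace 'rV[R]_(\sum_(j < J) L j)},
          (Q' <= Q)%VS -> Q' != Q -> mu [set b | b \in Q'] <> 1%E].

(* The set L^0. Here the component 0 means "absent", and the component l >= 1
   corresponds to the index l - 1 of 'I_(L j), i.e. it is lift ord0 of it. *)
Definition idx0 (J : nat) (L : 'I_J -> nat) :=
  {dffun forall j : 'I_J, 'I_(L j).+1}.

(* L^0 \ L: some component vanishes. *)
Definition idxcol (J : nat) (L : 'I_J -> nat) :=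
  {l : idx0 L | [exists j, l j == ord0]}.

Definition idxrow (J : nat) (L : 'I_J -> nat) := {j : 'I_J & 'I_(L j)}.

Definition moment (R : realType) (J : nat) (L : 'I_J -> nat)
    (mu : probability (coefSpace R L) R) (l : idx0 L) : R :=
  \int[mu]_(b in [set: coefSpace R L])
    \prod_(j < J) (if unlift ord0 (l j) is Some k then coef b k else 1).

(* The j-th component of l is replaced by (the encoding of) k; this is l + k_j
   when the j-th component of l is 0, the only case where it is used. *)
Definition add_idx (J : nat) (L : 'I_J -> nat) (l : idx0 L) (j : 'I_J)
    (k : 'I_(L j)) : idx0 L :=
  [ffun i => @dfwith _ (fun i0 => 'I_(L i0).+1) (fun i0 => l i0) j (lift ord0 k) i].

(* An incomplete matrix; None stands for an unspecified entry. *)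
Definition incomplete_matrix (F : Type) (I C : finType) := I -> C -> option F.

Definition moment_matrix (R : realType) (J : nat) (L : 'I_J -> nat)
    (mu : probability (coefSpace R L) R) :
    incomplete_matrix R (idxrow L) (idxcol L) :=
  fun r c => if val c (tag r) == ord0
             then Some (moment mu (add_idx (val c) (tagged r))) else None.

(* m has a nonzero minor of size r all of whose entries are known. *)
Definition has_known_minor (F : fieldType) (I C : finType)
    (m : incomplete_matrix F I C) (r : nat) : bool :=
  [exists f : {ffun 'I_r -> I}, exists g : {ffun 'I_r -> C},
    [&& injectiveb f, injectiveb g,
        [forall i, forall k, m (f i) (g k) != None] &
        \det (\matrix_(i < r, k < r) odflt 0 (m (f i) (g k))) != 0]].

(* A minor has at most #|I| rows. *)
Definition incomplete_rank (F : fieldType) (I C : finType)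
    (m : incomplete_matrix F I C) : nat :=
  \max_(r < #|I|.+1 | has_known_minor m r) r.

(* Main.v *)
Require Import Defs.
From HB Require Import structures.
From mathcomp Require Import all_boot all_order all_algebra.
From mathcomp Require Import all_classical all_reals all_analysis.
From mathcomp Require Import measurable_realfun.
Import numFieldNormedType.Exports.
Local Open Scope classical_set_scope.
Local Open Scope ring_scope.

(** Fix a column index c of the moment matrix and let w_c(beta) be the product
    of the coordinates beta_{j c_j} over the j with c_j present ([monom]).
    Consider the vector
      v_c = integral of w_c(beta) beta mu(d beta)   in R^|L|.
    Its entry at (j, k) is the integral of beta_{jk} w_c(beta), and as soon as
    c_j is absent, beta_{jk} w_c(beta) is the monomial of the index c + k_j
    ([monom_add_idx]).  So v_c is a completion of the column c: every known
    entry of the column is the corresponding entry of v_c.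

    On the product of simplices all the monomials lie between 0 and 1, which
    makes the integrals finite.  As beta lies almost surely in the linear
    subspace Q, so does w_c(beta) beta, and a linear subspace is stable under
    integration ([Rintegral_in_vspace]): v_c lies in Q.  The moment matrix thus
    has a completion whose columns all lie in a space of dimension K, hence no
    known minor of size greater than K is nonzero
    ([incomplete_rank_le_dim]). *)

Set Implicit Arguments.
Unset Strict Implicit.
Unset Printing Implicit Defensive.
Import Order.TTheory GRing.Theory Num.Theory.

(** A completion whose columns lie in Q factors through the coordinates in a
    basis of Q, so that every minor of known entries is the determinant of a
    product of an r x (dim Q) matrix by a (dim Q) x r matrix. *)
Lemma incomplete_rank_le_dim (F : fieldType) (I C : finType) (n : nat)
    (m : incomplete_matrix F I C) (e : I -> 'I_n) (v : C -> 'rV[F]_n)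
    (Q : {vspace 'rV[F]_n}) :
  (forall c, v c \in Q) ->
  (forall i c, m i c != None -> m i c = Some (v c ord0 (e i))) ->
  (incomplete_rank m <= \dim Q)%N.
Proof.
move=> vQ mE; apply/bigmax_leqP => r /existsP[f /existsP[g]].
case/and4P => _ _ /forallP known; rewrite -unitfE -unitmxE => unit_minor.
have -> : nat_of_ord r = \rank (\matrix_(i < r, k < r) odflt 0 (m (f i) (g k))).
  by rewrite mxrank_unit.
pose B := \matrix_(i < r, p < \dim Q) (vbasis Q)`_p ord0 (e (f i)).
pose D := \matrix_(p < \dim Q, k < r) coord (vbasis Q) p (v (g k)).
suff -> : \matrix_(i < r, k < r) odflt 0 (m (f i) (g k)) = B *m D.
  by rewrite (leq_trans (mxrankM_maxr _ _))// rank_leq_row.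
apply/matrixP => i k; rewrite !mxE mE ?(forallP (known i))//=.
rewrite {1}(coord_vbasis (vQ (g k))) summxE; apply: eq_bigr => p _.
by rewrite !mxE mulrC.
Qed.

(** Describing a subspace by linear equations on the entries, instead of by
    generators, is what measurability and integration can deal with. *)
Lemma memv_projE (F : fieldType) (n : nat) (Q : {vspace 'rV[F]_n}) v :
  (v \in Q) = (v == v *m lin1_mx (projv Q)).
Proof.
rewrite mul_rV_lin1; apply/idP/eqP => [/projv_id //|->].
exact: memv_proj.
Qed.

Lemma measurable_vspace d (T : measurableType d) (R : realType) (n : nat)
    (Y : T -> 'rV[R]_n) (Q : {vspace 'rV[R]_n}) :
  (forall i, measurable_fun setT (fun x => Y x ord0 i)) ->
  measurable [set x | Y x \in Q].
Proof.
move=> mY; set A := lin1_mx (projv Q).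
have -> : [set x | Y x \in Q] =
    \bigcap_(i in [set: 'I_n])
      (fun x => Y x ord0 i - (Y x *m A) ord0 i) @^-1` [set 0].
  apply/seteqP; split => x /=.
    by rewrite memv_projE => /eqP YxQ i _ /=; rewrite -YxQ subrr.
  move=> YxQ; rewrite memv_projE; apply/eqP/rowP => i.
  by apply/eqP; rewrite -subr_eq0; apply/eqP; exact: (YxQ i I).
apply: fin_bigcap_measurable => // i _.
rewrite -[X in measurable X]setTI.
apply: (measurable_funB (mY i)) => //.
under eq_fun do rewrite mxE.
by apply: measurable_sum => k; exact: measurable_funM.
Qed.

(** The linear equations y = y A that define Q involve finitely many entries,
    hence they commute with the integral. *)
Lemma Rintegral_in_vspace d (T : measurableType d) (R : realType)
    (mu : {measure set T -> \bar R}) (n : nat) (Y : T -> 'rV[R]_n)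
    (Q : {vspace 'rV[R]_n}) :
  (forall i, mu.-integrable setT (fun x => (Y x ord0 i)%:E)) ->
  {ae mu, forall x, Y x \in Q} ->
  \row_i \int[mu]_x Y x ord0 i \in Q.
Proof.
move=> intY YQ; set A := lin1_mx (projv Q).
have mY i : measurable_fun setT (fun x => Y x ord0 i).
  by apply/measurable_EFinP; exact: measurable_int (intY i).
have intYA i k : mu.-integrable setT (fun x => (Y x ord0 k * A k i)%:E).
  under eq_fun do rewrite mulrC EFinM.
  exact: integrableZl.
rewrite memv_projE; apply/eqP/rowP => i; rewrite !mxE.
transitivity (fine (\int[mu]_x (\sum_k (Y x ord0 k * A k i)%:E))%E).
  congr fine; apply: ae_eq_integral => //.
  - exact/measurable_EFinP.
  - by apply: emeasurable_sum => k; exact: measurable_int (intYA i k).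
  - apply: filterS YQ => x; rewrite memv_projE => /eqP YxQ _.
    by rewrite {1}YxQ mxE sumEFin.
rewrite integral_sum// -sum_fine => [|k _]; last exact: integrable_fin_num.
apply: eq_bigr => k _; rewrite !mxE mulrC -RintegralZl//; last exact: intY.
by apply: eq_Rintegral => x _; rewrite mulrC.
Qed.

Lemma prob1_ae d (T : measurableType d) (R : realType) (P : probability T R)
    (A : set T) : measurable A -> P A = 1%E -> {ae P, forall x, A x}.
Proof.
move=> mA PA1; exists (~` A); split => //; first exact: measurableC.
by rewrite probability_setC// PA1 subee.
Qed.

(** The bound is only required almost everywhere because monomials in beta are
    bounded on the product of simplices, not on the whole space. *)
Lemma ae_bounded_integrable d (T : measurableType d) (R : realType)
    (mu : {finite_measure set T -> \bar R}) (f : T -> R) (M : R) :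
  measurable_fun setT f -> {ae mu, forall x, `|f x| <= M} ->
  mu.-integrable setT (EFin \o f).
Proof.
move=> mf [N [mN muN0 fN]].
have mfE : measurable_fun setT (EFin \o f) by exact/measurable_EFinP.
apply/(negligible_integrable mN measurableT mfE muN0).
apply: measurable_bounded_integrable => //.
- exact: measurableD.
- by rewrite ltey_eq fin_num_measure//; exact: measurableD.
- exact: measurable_funTS.
exists M; split; rewrite ?num_real// => M' MM' x [_ /= Nx].
apply: (le_trans _ (ltW MM')); apply: contrapT => fxM.
exact/Nx/fN.
Qed.

Section coefficients.
Variables (R : realType) (J : nat) (L : 'I_J -> nat).
Implicit Types (c : idx0 L) (b : coefSpace R L).

Lemma measurable_coord (i : 'I_(\sum_(j < J) L j)) :
  measurable_fun setT
    (fun b : coefSpace R L => (b : 'rV[R]_(\sum_(j < J) L j)) ord0 i).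
Proof.
apply: (measurability _ (RGenOpens.measurableE R)).
move=> _ [_ [a [b' ->]] <-]; rewrite setTI; apply: sub_sigma_algebra.
apply: open_comp; last exact: interval_open.
by move=> x _; exact: coord_continuous.
Qed.

Lemma measurable_coef (j : 'I_J) (l : 'I_(L j)) :
  measurable_fun setT (fun b : coefSpace R L => coef b l).
Proof. exact: measurable_coord. Qed.

(** The value of mu on a set says something about almost every point only when
    that set is measurable, so this is what turns mu S^L = 1 into an almost
    sure statement. *)
Lemma measurable_simplices : measurable (@simplices R J L).
Proof.
have -> : @simplices R J L =
    (\bigcap_(j in [set: 'I_J]) \bigcap_(l in [set: 'I_(L j)])
      (fun b => coef b l) @^-1` `[0, +oo[) `&`
    \bigcap_(j in [set: 'I_J])
      (fun b => \sum_(l < L j) coef b l) @^-1` [set 1].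
  apply/seteqP; split => b /= [b0 b1]; split => [j|j].
  - by move=> _ l _ /=; rewrite in_itv/= b0.
  - by move=> _; exact: b1.
  - by move=> l; have := b0 j I l I; rewrite /= in_itv/= andbT.
  - exact: b1.
apply: measurableI; apply: fin_bigcap_measurable => // j _.
  apply: fin_bigcap_measurable => // l _.
  by rewrite -[X in measurable X]setTI; exact: measurable_coef.
rewrite -[X in measurable X]setTI.
by apply: measurable_sum => // l; exact: measurable_coef.
Qed.

Lemma simplices_coef_le1 b (j : 'I_J) (l : 'I_(L j)) :
  simplices b -> 0 <= coef b l <= 1.
Proof.
move=> [b0 b1]; rewrite b0/= -(b1 j) (bigD1 l)//= lerDl.
by apply: sumr_ge0 => l' _; exact: b0.
Qed.

Definition monom c b : R :=
  \prod_(j < J) (if unlift ord0 (c j) is Some k then coef b k else 1).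

Lemma measurable_monom c : measurable_fun setT (monom c).
Proof.
apply: measurable_prod => j _; case: (unlift _ _) => [k|].
  exact: measurable_coef.
exact: measurable_cst.
Qed.

Lemma simplices_monom_le1 c b : simplices b -> 0 <= monom c b <= 1.
Proof.
move=> bS; have factor01 j :
    0 <= (if unlift ord0 (c j) is Some k then coef b k else 1) <= 1.
  by case: (unlift _ _) => [k|]; rewrite ?ler01 ?lexx//; exact: simplices_coef_le1.
rewrite /monom prodr_ge0/= => [|j _]; last by case/andP: (factor01 j).
by apply: Num.Theory.prodr_ile1 => j _; exact: factor01.
Qed.

(** The factor of [monom c] at j is 1 precisely because the component j is
    absent from c; filling it with k contributes one coordinate. *)
Lemma monom_add_idx c b (j : 'I_J) (k : 'I_(L j)) :
  c j = ord0 -> monom (add_idx c k) b = coef b k * monom c b.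
Proof.
move=> cj0; rewrite /monom (bigD1 j)//= [in RHS](bigD1 j)//= cj0 unlift_none.
rewrite mul1r ffunE dfwithin liftK; congr (_ * _).
by apply: eq_bigr => i ij; rewrite ffunE dfwithout// eq_sym.
Qed.

End coefficients.

Theorem corollary7p4 (R : realType) (J : nat) (L : 'I_J -> nat) (K : nat)
    (hJ : (1 <= J)%N) (hL : forall j : 'I_J, (1 <= L j)%N)
    (mu : probability (coefSpace R L) R)
    (hmu : mu (@simplices R J L) = 1%E)
    (d : measure_display) (Omega : measurableType d)
    (P : probability Omega R)
    (beta : {RV P >-> coefSpace R L})
    (hbeta : forall B : set (coefSpace R L), measurable B ->
       distribution P beta B = mu B)
    (X : forall j : 'I_J, Omega -> 'I_(L j))
    (mX : forall (j : 'I_J) (l : 'I_(L j)), measurable (X j @^-1` [set l]))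
    (hX : forall (j : 'I_J) (l : 'I_(L j)),
       is_cond_prob beta (X j @^-1` [set l]) (fun b => coef b l))
    (hG1 : G1 beta X) (hG2 : G2 mu K) :
  (incomplete_rank (moment_matrix mu) <= K)%N.
Proof.
case: hG2 => Q [<- muQ _].
have aeS := prob1_ae (@measurable_simplices R J L) hmu.
have mQ : measurable [set b : coefSpace R L | b \in Q].
  by apply: measurable_vspace => i; exact: measurable_coord.
have aeQ := prob1_ae mQ muQ.
pose Y (c : idx0 L) (b : coefSpace R L) :=
  monom c b *: (b : 'rV[R]_(\sum_(j < J) L j)).
have YE c b i : Y c b ord0 i = monom c b * coef b (tagnat.sig2 i).
  by rewrite /Y mxE /coef tagnat.sig2K.
(* The integrals of the vectors Y c are the columns of the completion. *)
refine (@incomplete_rank_le_dim _ _ _ _ _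
  (fun r : idxrow L => @tagnat.Rank _ L (tag r) (tagged r))
  (fun c => \row_i \int[mu]_b Y (val c) b ord0 i) Q _ _).
- move=> c; apply: Rintegral_in_vspace.
  + move=> i; apply: (@ae_bounded_integrable _ _ _ _ _ 1).
      apply: (@eq_measurable_fun _ _ _ _ _
        (fun b => monom (val c) b * coef b (tagnat.sig2 i))).
        by move=> b _; rewrite YE.
      by apply: measurable_funM; [exact: measurable_monom|exact: measurable_coef].
    apply: filterS aeS => b bS.
    have /andP[w0 w1] := simplices_monom_le1 (val c) bS.
    have /andP[b0 b1] := simplices_coef_le1 (tagnat.sig2 i) bS.
    by rewrite YE ger0_norm ?mulr_ge0// mulr_ile1.
  + by apply: filterS aeQ => b bQ; exact: memvZ.
- move=> [j k] c; rewrite /moment_matrix/=; case: ifP => // /eqP cj0 _.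
  congr (Some _); rewrite mxE; apply: eq_Rintegral => b _.
  by rewrite -/(monom _ b) monom_add_idx// mxE mulrC.
Qed.
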